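(* Let $N\ge 2$, let $k_1,\dots,k_N$ be real numbers, and let $c(i,j)=k_ik_j$ for $1\le i<j\le N$. Let $\beta^+$ and $\beta^-$ be the associated critical inverse temperatures. If $\beta^+$ is finite, then $$\beta^+\ge\frac{1}{\max_{1\le i\le N}k_i^2}.$$ If $\beta^-$ is finite, then $$\beta^-\le-\frac{1}{\big(\sum_{i=1}^N k_i^2\big)-\min_{1\le i\le N}k_i^2}.$$
   Context: Given real numbers $c(i,j)$, $1\le i<j\le N$, set $$T^+=-\min_S\frac{\sum_{i,j\in S:\,i<j}c(i,j)}{|S|-1},\qquad T^-=-\max_S\frac{\sum_{i,j\in S:\,i<j}c(i,j)}{|S|-1},$$ where $S$ ranges over all subsets of $\{1,\dots,N\}$ with $|S|\ge 2$. The critical inverse temperatures are $\beta^-=1/T^-$ if $T^-<0$ and $\beta^-=-\infty$ otherwise; $\beta^+=1/T^+$ if $T^+>0$ and $\beta^+=\infty$ otherwise. (Equivalently, $(\beta^-,\beta^+)$ is the set of real $\beta$ for which $\int_{(\mathbb{S}^2)^N}\prod_{i<j}d(p_i,p_j)^{2c(i,j)\beta}\,\mathrm{d}V^{\otimes N}<\infty$, with $d$ the chordal distance on the unit sphere $\mathbb{S}^2$ and $\mathrm{d}V$ the normalized rotation-invariant volume form.) *)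

(* Defs.v *)
From HB Require Import structures.
From mathcomp Require Import all_boot all_order all_algebra.
From mathcomp Require Import constructive_ereal reals.

Set Implicit Arguments.
Unset Strict Implicit.
Unset Printing Implicit Defensive.

Import Order.TTheory GRing.Theory Num.Theory.
Local Open Scope ring_scope.

(* The value is the junk 0 when no i satisfies P; in particular this never
   happens for the subsets of size at least 2 of 'I_N when N >= 2. *)
Definition finmin (R : realType) (I : finType) (P : pred I) (f : I -> R) : R :=
  if [pick i | P i] is Some i0 then f [arg min_(i < i0 | P i) f i]%O else 0.

Definition finmax (R : realType) (I : finType) (P : pred I) (f : I -> R) : R :=
  if [pick i | P i] is Some i0 then f [arg max_(i > i0 | P i) f i]%O else 0.

Lemma finminP (R : realType) (I : finType) (P : pred I) (f : I -> R) :
  (exists i, P i) ->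
  (exists2 i, P i & finmin P f = f i) /\ (forall i, P i -> finmin P f <= f i).
Proof.
case=> j Pj; rewrite /finmin; case: pickP => [i0 Pi0|/(_ j)]; last by rewrite Pj.
by case: arg_minP => // i Pi mini; split=> //; exists i.
Qed.

Lemma finmaxP (R : realType) (I : finType) (P : pred I) (f : I -> R) :
  (exists i, P i) ->
  (exists2 i, P i & finmax P f = f i) /\ (forall i, P i -> f i <= finmax P f).
Proof.
case=> j Pj; rewrite /finmax; case: pickP => [i0 Pi0|/(_ j)]; last by rewrite Pj.
by case: arg_maxP => // i Pi maxi; split=> //; exists i.
Qed.

(* The indices 1, ..., N are represented by 'I_N, and c i j is only ever used
   for i < j. *)
Definition energy_ratio (R : realType) (N : nat) (c : 'I_N -> 'I_N -> R)
    (S : {set 'I_N}) : R :=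
  (\sum_(i in S) \sum_(j in S | (i < j)%N) c i j) / (#|S|%:R - 1).

Definition Tplus (R : realType) (N : nat) (c : 'I_N -> 'I_N -> R) : R :=
  - finmin (fun S : {set 'I_N} => (2 <= #|S|)%N) (energy_ratio c).

Definition Tminus (R : realType) (N : nat) (c : 'I_N -> 'I_N -> R) : R :=
  - finmax (fun S : {set 'I_N} => (2 <= #|S|)%N) (energy_ratio c).

Definition beta_plus (R : realType) (N : nat) (c : 'I_N -> 'I_N -> R) : \bar R :=
  if 0 < Tplus c then (1 / Tplus c)%:E else +oo%E.

Definition beta_minus (R : realType) (N : nat) (c : 'I_N -> 'I_N -> R) : \bar R :=
  if Tminus c < 0 then (1 / Tminus c)%:E else -oo%E.

(* Main.v *)
(* For a subset S of size n >= 2, twice the sum of k_i k_j over i < j in S equals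
   (sum k_i)^2 - sum k_i^2.  Dropping the square bounds this below by
   - sum k_i^2 >= - n max k_i^2 >= - 2 (n - 1) max k_i^2, and Cauchy-Schwarz
   bounds it above by (n - 1) sum_(i in S) k_i^2.  Finally, half of
   sum_(i in S) k_i^2 is at least min k_i^2, again because n >= 2. *)
Require Import Defs.
From mathcomp Require Import all_boot all_order all_algebra.
From mathcomp Require Import constructive_ereal reals.
From mathcomp Require Import ring lra.
Import Order.TTheory GRing.Theory Num.Theory.
Local Open Scope ring_scope.

(** Expanding the square over ordered pairs gives the diagonal and two triangles, which are equal by
    symmetry of the product. *)
Lemma double_sum_lt_pairs (R : comPzRingType) (N : nat) (k : 'I_N -> R)
    (S : {set 'I_N}) :
  (\sum_(i in S) \sum_(j in S | (i < j)%N) k i * k j) *+ 2 =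
  (\sum_(i in S) k i) ^+ 2 - \sum_(i in S) k i ^+ 2.
Proof.
pose L := \sum_(i in S) \sum_(j in S | (i < j)%N) k i * k j.
have LE : \sum_(i in S) \sum_(j in S | (j < i)%N) k i * k j = L.
  rewrite /L (exchange_big_dep (mem S)) /=; last by move=> i j _ /andP[].
  apply: eq_bigr => i iS; apply: eq_big => j; first by rewrite iS.
  by rewrite mulrC.
have splitE : (\sum_(i in S) k i) ^+ 2 = \sum_(i in S) k i ^+ 2 + (L + L).
  (* One copy of [L] becomes the lower triangle, so the identity can be checked row by row. *)
  rewrite -{2}LE /L -!big_split /= expr2 mulr_suml; apply: eq_bigr => i iS.
  rewrite mulr_sumr (bigD1 i) //= -expr2; congr (_ + _).
  rewrite (bigID (fun j : 'I_N => (i < j)%N)) /=.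
  congr (_ + _); apply: eq_bigl => j; rewrite -val_eqE -andbA;
    by case: ltngtP.
by rewrite splitE mulr2n addrAC subrr add0r.
Qed.

(** Lagrange's identity: the sum of squared differences over all ordered pairs is twice the gap
    between the two sides. *)
Lemma sqr_sum_le_card (R : realDomainType) (I : finType) (k : I -> R)
    (S : {set I}) :
  (\sum_(i in S) k i) ^+ 2 <= #|S|%:R * \sum_(i in S) k i ^+ 2.
Proof.
have : 0 <= \sum_(i in S) \sum_(j in S) (k i - k j) ^+ 2.
  by do 2![apply: sumr_ge0 => ? _]; exact: sqr_ge0.
have -> : \sum_(i in S) \sum_(j in S) (k i - k j) ^+ 2 =
    (#|S|%:R * \sum_(i in S) k i ^+ 2 - (\sum_(i in S) k i) ^+ 2) *+ 2.
  pose s := \sum_(i in S) k i; pose q := \sum_(i in S) k i ^+ 2.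
  transitivity (\sum_(i in S) (#|S|%:R * k i ^+ 2 - k i * (s *+ 2) + q)).
    apply: eq_bigr => i _; under eq_bigr do rewrite sqrrB.
    rewrite !big_split /= sumr_const sumrN sumrMnl -mulr_sumr.
    by rewrite mulr_natl mulrnAr.
  rewrite !big_split /= sumrN -mulr_suml -mulr_sumr sumr_const -/s -/q.
  by rewrite -[q *+ _]mulr_natl; ring.
by rewrite pmulrn_lge0 // subr_ge0.
Qed.

Lemma sum_set_le (R : numDomainType) (I : finType) (f : I -> R) (S : {set I})
    (M : R) :
  (forall i, f i <= M) -> \sum_(i in S) f i <= #|S|%:R * M.
Proof. by move=> fM; rewrite mulr_natl -sumr_const ler_sum. Qed.

Lemma sum_set_ge (R : numDomainType) (I : finType) (f : I -> R) (S : {set I})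
    (m : R) :
  (forall i, m <= f i) -> #|S|%:R * m <= \sum_(i in S) f i.
Proof. by move=> mf; rewrite mulr_natl -sumr_const ler_sum. Qed.

Lemma energy_ratio_bounds (R : realType) (N : nat) (k : 'I_N -> R)
    (c : 'I_N -> 'I_N -> R) (S : {set 'I_N}) (m M : R) :
  (forall i j : 'I_N, (i < j)%N -> c i j = k i * k j) ->
  (2 <= #|S|)%N -> (forall i, m <= k i ^+ 2) -> (forall i, k i ^+ 2 <= M) ->
  - M <= energy_ratio c S <= \sum_(i < N) k i ^+ 2 - m.
Proof.
move=> hc S2 hm hM; rewrite /energy_ratio.
have -> : \sum_(i in S) \sum_(j in S | (i < j)%N) c i j =
    \sum_(i in S) \sum_(j in S | (i < j)%N) k i * k j.
  by apply: eq_bigr => i _; apply: eq_bigr => j /andP[_ /hc].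
have pairsE := double_sum_lt_pairs _ _ k S.
have CS := sqr_sum_le_card _ _ k S.
have qM := sum_set_le _ _ _ S _ hM.
have mq := sum_set_ge _ _ _ S _ hm.
have qQ : \sum_(i in S) k i ^+ 2 <= \sum_(i < N) k i ^+ 2.
  rewrite [leRHS](bigID (mem S)) /= lerDl.
  by apply: sumr_ge0 => i _; exact: sqr_ge0.
have q0 : 0 <= \sum_(i in S) k i ^+ 2 by apply: sumr_ge0 => i _; exact: sqr_ge0.
have s0 := sqr_ge0 (\sum_(i in S) k i).
have n2 : 2 <= #|S|%:R :> R by rewrite ler_nat.
have [i0 _] : exists i, i \in S by apply/card_gt0P; exact: ltnW.
have M0 : 0 <= M := le_trans (sqr_ge0 _) (hM i0).
move: pairsE CS qM mq qQ q0 s0 n2.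
set e := (\sum_(i in S) \sum_(j in S | _) _).
set s := (\sum_(i in S) k i) ^+ 2; set q := \sum_(i in S) k i ^+ 2.
set Q := \sum_(i < N) _; set n := _%:R => pairsE CS qM mq qQ q0 s0 n2.
have n1 : 0 < n - 1 by lra.
(* [m] is an arbitrary lower bound and may be negative: either [2 * m <= n * m <= q], or
   [2 * m < 0 <= q]. *)
have mq2 : m *+ 2 <= q.
  by case: (lerP 0 m) => m0; [apply: le_trans mq; nra | lra].
(* Below, [(n - 2) * M >= 0] gives [n * M <= 2 * (n - 1) * M]. Above, [q <= Q] and [2 * m <= q] give
   [q <= 2 * (Q - m)], which is then multiplied by [n - 1]. *)
by rewrite ler_pdivlMr // ler_pdivrMr //; apply/andP; split; nra.
Qed.

Theorem corollary1p4 (R : realType) (N : nat) (hN : (2 <= N)%N)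
    (k : 'I_N -> R) (c : 'I_N -> 'I_N -> R)
    (hc : forall i j : 'I_N, (i < j)%N -> c i j = k i * k j) :
  (beta_plus c \is a fin_num ->
     ((1 / finmax predT (fun i : 'I_N => k i ^+ 2))%:E <= beta_plus c)%E) /\
  (beta_minus c \is a fin_num ->
     (beta_minus c <=
        (- (1 / (\sum_(i < N) k i ^+ 2
                  - finmin predT (fun i : 'I_N => k i ^+ 2))))%:E)%E).
Proof.
(* With both ranges nonempty, every extremum is attained and the default value 0 never occurs. *)
have exI : exists i : 'I_N, predT i by exists (Ordinal (ltnW hN)).
have exS : exists S : {set 'I_N}, (2 <= #|S|)%N.
  by exists setT; rewrite cardsT card_ord.
have [_ hm] := @finminP R _ predT (fun i => k i ^+ 2) exI.
have [_ hM] := @finmaxP R _ predT (fun i => k i ^+ 2) exI.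
have bounds S S2 := energy_ratio_bounds _ _ k c S _ _ hc S2
  (fun i => hm i isT) (fun i => hM i isT).
split.
- rewrite /beta_plus /Tplus.
  have [[S S2 ->] _] := finminP (energy_ratio c) exS.
  have /andP[lb _] := bounds S S2.
  case: ifP => // T0 _.
  (* Here [T0] and [lb] give [0 < Tplus c <= max k_i^2], so the maximum is positive and inversion
     reverses the order. *)
  by rewrite lee_fin !div1r lef_pV2 ?posrE //; lra.
- rewrite /beta_minus /Tminus.
  have [[S S2 ->] _] := finmaxP (energy_ratio c) exS.
  have /andP[_ ub] := bounds S S2.
  case: ifP => // T0 _.
  (* The ratio at the maximizer [S] is positive by [T0], hence so is its upper bound [ub]; the two
     signs cancel before inverting. *)
  by rewrite lee_fin !div1r invrN lerN2 lef_pV2 ?posrE //; lra.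
Qed.
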